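(* Let $c\in(0,\infty]$. For every $g\in U(1)$ one has $\delta_g\circ\chi_c=\chi_c\circ\delta_g$ as maps $C(S^2_{qc})\to C(S^2_{q\infty})$ (on the left $\delta_g$ acts on $C(S^2_{q\infty})$, on the right $\delta_g$ acts on $C(S^2_{qc})$).
   Context: Fix $q\in\mathbb{R}$ with $0<|q|<1$. All algebras are unital and over $\mathbb{C}$. The $C^*$-closure of a $*$-algebra means the completion with respect to the supremum norm over all $*$-representations in bounded operators. $C(S^2_{q\infty})$ is the $C^*$-closure of $P(S^2_{q\infty})$, the quotient of the free $*$-algebra $\mathbb{C}\langle A,B\rangle$ by the two-sided $*$-ideal generated by $A^*=A$, $BA=q^2AB$, $B^*B=-A^2+I$, $BB^*=-q^4A^2+I$. For $c\in(0,\infty)$, $C(S^2_{qc})$ is the $C^*$-closure of $P(S^2_{qc})$, the quotient of $\mathbb{C}\langle A_c,B_c\rangle$ by the two-sided $*$-ideal generated by $A_c^*=A_c$, $B_cA_c=q^2A_cB_c$, $B_c^*B_c=A_c-A_c^2+cI$, $B_cB_c^*=q^2A_c-q^4A_c^2+cI$. For $c=\infty$ we write $A_\infty=A$, $B_\infty=B$. Let $\{e_k\}_{k\in\mathbb{N}}$ ($k\ge 0$) be an orthonormal basis of a Hilbert space. The representations $\pi_\pm=\pi^\infty_\pm$ of $C(S^2_{q\infty})$ are given by $\pi_\pm(A)e_k=\pm q^{2k}e_k$, $\pi_\pm(B)e_k=(1-q^{4k})^{1/2}e_{k-1}$ for $k\ge1$, $\pi_\pm(B)e_0=0$. For $c\in(0,\infty)$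 the representations $\pi^c_\pm$ of $C(S^2_{qc})$ are given by $\pi^c_\pm(A_c)e_k=\lambda_\pm q^{2k}e_k$, $\pi^c_\pm(B_c)e_k=c_\pm(k)^{1/2}e_{k-1}$ for $k\ge1$, $\pi^c_\pm(B_c)e_0=0$, where $\lambda_\pm=\frac12\pm(c+\frac14)^{1/2}$ and $c_\pm(k)=\lambda_\pm q^{2k}-(\lambda_\pm q^{2k})^2+c$. Let $C^*(\mathfrak{S})$ be the $C^*$-algebra generated by the one-sided shift $\mathfrak{S}e_i=e_{i+1}$, let $\sigma:C^*(\mathfrak{S})\to C(S^1)$ be the symbol map ($\mathfrak{S}\mapsto u$, with $u$ the unitary generator of $C(S^1)$), and let $C^*(\mathfrak{S})\oplus_\sigma C^*(\mathfrak{S}):=\{(a_1,a_2)\mid\sigma(a_1)=\sigma(a_2)\}$. It is known that for all $c\in(0,\infty]$, $\pi_+^c\oplus\pi_-^c:C(S^2_{qc})\to C^*(\mathfrak{S})\oplus_\sigma C^*(\mathfrak{S})$ is a $C^*$-isomorphism; put $\chi_c:=(\pi_+\oplus\pi_-)^{-1}\circ(\pi^c_+\oplus\pi^c_-):C(S^2_{qc})\to C(S^2_{q\infty})$. For $c\in(0,\infty]$ and $g\in U(1)$, $\delta_g:C(S^2_{qc})\to C(S^2_{qc})$ is the $C^*$-automorphism determined by $\delta_g(A_c)=A_c$, $\delta_g(B_c)=g^2B_c$ (it comes from the coaction $\delta:C(S^2_{qc})\to C(S^2_{qc})\otimes C(U(1))$, $\delta(A_c)=A_c\otimes1$, $\delta(B_c)=B_c\otimes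 u^2$, via $\delta_g(a)=\delta(a)(g)$). *)

(* Defs.v *)
From HB Require Import structures.
From mathcomp Require Import all_boot all_order all_algebra.
From mathcomp Require Import generic_quotient complex.
From mathcomp Require Import all_classical all_reals all_analysis.

Set Implicit Arguments.
Unset Strict Implicit.
Unset Printing Implicit Defensive.

Import Order.TTheory GRing.Theory Num.Theory numFieldNormedType.Exports.

Local Open Scope classical_set_scope.
Local Open Scope quotient_scope.
Local Open Scope ring_scope.

(** ** Unital complex *-algebras *)

HB.mixin Record isStarAlgebra (R : realType) A of GRing.Algebra R[i] A := {
  star : A -> A;
  starD : forall a b : A, star (a + b) = star a + star b;
  starZ : forall (k : R[i]) (a : A), star (k *: a) = Num.conj k *: star a;
  starM : forall a b : A, star (a * b) = star b * star a;
  starK : involutive star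
}.

#[short(type="starAlgType")]
HB.structure Definition StarAlgebra (R : realType) :=
  {A of GRing.Algebra R[i] A & isStarAlgebra R A}.

(* The norm is a separate real-valued operation because the hierarchies of
   rings and of normed modules have no common extension for general rings. *)
HB.mixin Record isCStarAlgebra (R : realType) A of StarAlgebra R A := {
  cnorm : A -> R;
  cnorm_eq0 : forall a : A, cnorm a = 0 -> a = 0;
  cnormD : forall a b : A, cnorm (a + b) <= cnorm a + cnorm b;
  cnormZ : forall (k : R[i]) (a : A),
    cnorm (k *: a) = complex.Re `|k| * cnorm a;
  cnormM : forall a b : A, cnorm (a * b) <= cnorm a * cnorm b;
  cnorm_star : forall a : A, cnorm (star a * a) = cnorm a ^+ 2;
  cnorm_complete : forall u : nat -> A,
    (forall eps : R, 0 < eps -> exists N, forall m n,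
       (N <= m)%N -> (N <= n)%N -> cnorm (u m - u n) < eps) ->
    exists l : A, cnorm (u n - l) @[n --> \oo] --> (0 : R)
}.

#[short(type="cstarAlgType")]
HB.structure Definition CStarAlgebra (R : realType) :=
  {A of StarAlgebra R A & isCStarAlgebra R A}.

Definition star_preserving (R : realType) (A B : starAlgType R) (f : A -> B) :
    Prop :=
  forall a, f (star a) = star (f a).

(* The contractivity clause is automatic for *-homomorphisms between
   C*-algebras; it is listed so that continuity is part of the notion. *)
Definition cstar_automorphism (R : realType) (A : cstarAlgType R)
    (f : {lrmorphism A -> A}) : Prop :=
  [/\ star_preserving f, bijective f & forall a, cnorm (f a) <= cnorm a].

(** ** Hilbert spaces and operators *)

(* The inner product is linear in its first argument. *)
HB.mixin Record isHilbert (R : realType) V of CompleteNormedModule R[i] V := {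
  inner : V -> V -> R[i];
  inner_linear : forall (k : R[i]) (u v w : V),
    inner (k *: u + v) w = k * inner u w + inner v w;
  inner_conj : forall u v : V, inner v u = Num.conj (inner u v);
  inner_norm : forall u : V, inner u u = `|u| ^+ 2
}.

#[short(type="hilbertType")]
HB.structure Definition Hilbert (R : realType) :=
  {V of CompleteNormedModule R[i] V & isHilbert R V}.

Section Operators.
Context (R : realType) (H : hilbertType R).

Definition orthonormal_basis (e : nat -> H) : Prop :=
  (forall i j, inner (e i) (e j) = (i == j)%:R) /\
  (forall v : H, series (fun k => inner v (e k) *: e k) @ \oo --> v).

Definition bounded_operator (T : H -> H) : Prop :=
  linear T /\ exists M : R[i], forall v, `|T v| <= M * `|v|.

Definition adjoint_operators (T T' : H -> H) : Prop :=
  forall u v, inner (T u) v = inner u (T' v).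

(* The norm of a normedModType over R[i] is R[i]-valued (and real). *)
Definition operator_norm (T : H -> H) : \bar R :=
  ereal_sup [set (complex.Re `|T v|)%:E | v in [set v : H | `|v| <= 1]].

(* Unital *-representations by bounded operators. *)
Definition star_representation (A : starAlgType R) (p : A -> H -> H) : Prop :=
  (forall a, bounded_operator (p a)) /\
  [/\ p 1 = id,
      forall a b, p (a + b) = p a \+ p b,
      forall (k : R[i]) a, p (k *: a) = k \*: p a,
      forall a b, p (a * b) = p a \o p b
    & forall a, adjoint_operators (p a) (p (star a))].

(* As for cstar_automorphism, contractivity is automatic. *)
Definition cstar_representation (A : cstarAlgType R) (p : A -> H -> H) : Prop :=
  star_representation p /\ forall a, (operator_norm (p a) <= (cnorm a)%:E)%E.

(* Norm-closed unital *-subalgebras of B(H). *)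
Definition cstar_subalgebra (F : set (H -> H)) : Prop :=
  F `<=` bounded_operator /\
  [/\ F id /\ (forall S T, F S -> F T -> F (S \+ T)),
      forall (k : R[i]) T, F T -> F (k \*: T),
      forall S T, F S -> F T -> F (S \o T),
      forall T T', F T -> bounded_operator T' -> adjoint_operators T T' -> F T'
    & forall T, bounded_operator T ->
        (forall eps : R, 0 < eps ->
           exists2 S, F S & (operator_norm (T \- S)%R <= eps%:E)%E) ->
        F T].

Definition generated_cstar (S : H -> H) : set (H -> H) :=
  smallest cstar_subalgebra [set S].

Definition is_shift (e : nat -> H) (S : H -> H) : Prop :=
  bounded_operator S /\ forall k, S (e k) = e k.+1.

Definition unit_circle : set R[i] := [set z | `|z| = 1].

(* A *-homomorphism from C*(S) to C(S^1) taking S to the identity function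
   of the circle.  Only the values of sigma at T in C*(S) and z in the circle
   are meaningful. *)
Definition symbol_map (S : H -> H) (sigma : (H -> H) -> R[i]^o -> R[i]^o) :
    Prop :=
  (forall T, generated_cstar S T ->
     {within (unit_circle : set R[i]^o), continuous (sigma T)} /\
     forall z, unit_circle z ->
       ((complex.Re `|sigma T z|)%:E <= operator_norm T)%E) /\
  forall z, unit_circle z ->
  [/\ sigma S z = z /\ sigma id z = 1,
      forall T1 T2, generated_cstar S T1 -> generated_cstar S T2 ->
        sigma (T1 \+ T2) z = sigma T1 z + sigma T2 z,
      forall (k : R[i]) T, generated_cstar S T ->
        sigma (k \*: T) z = k * sigma T z,
      forall T1 T2, generated_cstar S T1 -> generated_cstar S T2 ->
        sigma (T1 \o T2) z = sigma T1 z * sigma T2 z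
    & forall T T', generated_cstar S T -> generated_cstar S T' ->
        adjoint_operators T T' -> sigma T' z = Num.conj (sigma T z)].

Definition fibre_product (S : H -> H) (sigma : (H -> H) -> R[i]^o -> R[i]^o) :
    set ((H -> H) * (H -> H)) :=
  [set a | [/\ generated_cstar S a.1, generated_cstar S a.2
             & forall z, unit_circle z -> sigma a.1 z = sigma a.2 z]].

Definition rep_sum (A : Type) (p1 p2 : A -> H -> H) (a : A) :
    (H -> H) * (H -> H) := (p1 a, p2 a).

End Operators.

(** ** C*-closure *)

(* A completion of A for the supremum of ||p a|| over all *-representations p
   (and so also the quotient by the null space of that seminorm). *)
Record cstar_closure (R : realType) (A : starAlgType R) := CStarClosure {
  closure_alg :> cstarAlgType R;
  closure_in : {lrmorphism A -> closure_alg};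
  closure_in_star : star_preserving closure_in;
  closure_in_dense : forall (a : closure_alg) (eps : R), 0 < eps ->
    exists p : A, cnorm (a - closure_in p) < eps;
  closure_in_norm : forall a : A,
    (cnorm (closure_in a))%:E =
    ereal_sup [set r | exists (H : hilbertType R) (p : A -> H -> H),
                 star_representation p /\ r = operator_norm (p a)]
}.
Arguments closure_in {R A} c.

(** ** Free *-algebra *)

Inductive star_term (R : realType) (X : Type) : Type :=
| TGen of X
| TZero
| TOne
| TAdd of star_term R X & star_term R X
| TScale of R[i] & star_term R X
| TMul of star_term R X & star_term R X
| TStar of star_term R X.
Arguments TGen {R X} _.
Arguments TZero {R X}.
Arguments TOne {R X}.

(* The least congruence satisfying the axioms of unital complex *-algebras. *)
Inductive star_term_eq (R : realType) (X : Type) :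
    star_term R X -> star_term R X -> Prop :=
| te_refl a : star_term_eq a a
| te_sym a b : star_term_eq a b -> star_term_eq b a
| te_trans a b c : star_term_eq a b -> star_term_eq b c -> star_term_eq a c
| te_add a a' b b' : star_term_eq a a' -> star_term_eq b b' ->
    star_term_eq (TAdd a b) (TAdd a' b')
| te_scale k a a' : star_term_eq a a' ->
    star_term_eq (TScale k a) (TScale k a')
| te_mul a a' b b' : star_term_eq a a' -> star_term_eq b b' ->
    star_term_eq (TMul a b) (TMul a' b')
| te_star a a' : star_term_eq a a' -> star_term_eq (TStar a) (TStar a')
| te_addA a b c : star_term_eq (TAdd a (TAdd b c)) (TAdd (TAdd a b) c)
| te_addC a b : star_term_eq (TAdd a b) (TAdd b a)
| te_add0 a : star_term_eq (TAdd TZero a) a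
| te_addN a : star_term_eq (TAdd (TScale (-1) a) a) TZero
| te_scaleA k l a : star_term_eq (TScale k (TScale l a)) (TScale (k * l) a)
| te_scale1 a : star_term_eq (TScale 1 a) a
| te_scaleDr k a b :
    star_term_eq (TScale k (TAdd a b)) (TAdd (TScale k a) (TScale k b))
| te_scaleDl k l a :
    star_term_eq (TScale (k + l) a) (TAdd (TScale k a) (TScale l a))
| te_mulA a b c : star_term_eq (TMul a (TMul b c)) (TMul (TMul a b) c)
| te_mul1l a : star_term_eq (TMul TOne a) a
| te_mul1r a : star_term_eq (TMul a TOne) a
| te_mulDl a b c :
    star_term_eq (TMul (TAdd a b) c) (TAdd (TMul a c) (TMul b c))
| te_mulDr a b c :
    star_term_eq (TMul a (TAdd b c)) (TAdd (TMul a b) (TMul a c))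
| te_scaleMl k a b :
    star_term_eq (TScale k (TMul a b)) (TMul (TScale k a) b)
| te_scaleMr k a b :
    star_term_eq (TScale k (TMul a b)) (TMul a (TScale k b))
| te_starD a b :
    star_term_eq (TStar (TAdd a b)) (TAdd (TStar a) (TStar b))
| te_starZ k a :
    star_term_eq (TStar (TScale k a)) (TScale (Num.conj k) (TStar a))
| te_starM a b :
    star_term_eq (TStar (TMul a b)) (TMul (TStar b) (TStar a))
| te_starK a : star_term_eq (TStar (TStar a)) a.

(* The *-character of the free *-algebra with prescribed values on the
   generators, used to see that the algebras below are nonzero. *)
Fixpoint term_char (R : realType) (X : Type) (f : X -> R[i])
    (t : star_term R X) : R[i] :=
  match t with
  | TGen x => f x
  | TZero => 0
  | TOne => 1
  | TAdd a b => term_char f a + term_char f b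
  | TScale k a => k * term_char f a
  | TMul a b => term_char f a * term_char f b
  | TStar a => Num.conj (term_char f a)
  end.

Lemma term_charP (R : realType) (X : Type) (f : X -> R[i]) a b :
  star_term_eq a b -> term_char f a = term_char f b.
Proof.
elim=> //=; intros; rewrite ?rmorphD ?rmorphM ?conjCK ?add0r ?mul1r ?mulr1;
  rewrite ?mulN1r ?addNr ?mulrDl ?mulrDr ?addrA ?mulrA //; try congruence.
- exact: addrC.
- by rewrite (mulrC k).
- exact: mulrC.
Qed.

HB.instance Definition _ (R : realType) (X : Type) :=
  gen_eqMixin (star_term R X).
HB.instance Definition _ (R : realType) (X : Type) :=
  gen_choiceMixin (star_term R X).

Section FreeStarAlgebra.
Context (R : realType) (X : Type).
Notation term := (star_term R X).

Definition star_term_eqb (a b : term) : bool := `[< star_term_eq a b >].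

Lemma star_term_eqb_refl : reflexive star_term_eqb.
Proof. by move=> a; apply/asboolP; exact: te_refl. Qed.
Lemma star_term_eqb_sym : symmetric star_term_eqb.
Proof. by move=> a b; apply/asboolP/asboolP; exact: te_sym. Qed.
Lemma star_term_eqb_trans : transitive star_term_eqb.
Proof. by move=> b a c /asboolP ab /asboolP bc; apply/asboolP/(te_trans ab). Qed.

Canonical star_term_equiv :=
  EquivRel star_term_eqb star_term_eqb_refl star_term_eqb_sym
    star_term_eqb_trans.

Definition free_star := {eq_quot star_term_equiv}.
HB.instance Definition _ := Choice.on free_star.

Notation cl := (\pi_free_star).

Lemma free_eqP (a b : term) : star_term_eq a b <-> cl a = cl b.
Proof.
split=> [ab|/eqmodP /asboolP //].
by apply/eqmodP/asboolP.
Qed.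

Lemma repr_free (a : term) : star_term_eq (repr (cl a)) a.
Proof. by apply/free_eqP; rewrite reprK. Qed.

Definition free_gen (x : X) : free_star := cl (TGen x).
Definition free_zero : free_star := cl TZero.
Definition free_one : free_star := cl TOne.
Definition free_add (a b : free_star) : free_star := cl (TAdd (repr a) (repr b)).
Definition free_mul (a b : free_star) : free_star := cl (TMul (repr a) (repr b)).
Definition free_scale (k : R[i]) (a : free_star) : free_star :=
  cl (TScale k (repr a)).
Definition free_opp (a : free_star) : free_star := free_scale (-1) a.
Definition free_conj (a : free_star) : free_star := cl (TStar (repr a)).

Lemma free_addE a b : free_add (cl a) (cl b) = cl (TAdd a b).
Proof. by apply/free_eqP/te_add; exact: repr_free. Qed.
Lemma free_mulE a b : free_mul (cl a) (cl b) = cl (TMul a b).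
Proof. by apply/free_eqP/te_mul; exact: repr_free. Qed.
Lemma free_scaleE k a : free_scale k (cl a) = cl (TScale k a).
Proof. by apply/free_eqP/te_scale; exact: repr_free. Qed.
Lemma free_conjE a : free_conj (cl a) = cl (TStar a).
Proof. by apply/free_eqP/te_star; exact: repr_free. Qed.

Let freeE := (free_addE, free_mulE, free_scaleE, free_conjE).

Lemma free_ind (P : free_star -> Prop) : (forall t, P (cl t)) -> forall a, P a.
Proof. by move=> h a; rewrite -[a]reprK. Qed.

Ltac free_tac := 
  repeat (let a := fresh "a" in elim/free_ind => a);
  rewrite /free_opp /free_zero /free_one ?freeE; apply/free_eqP; by constructor.

Fact free_addA : associative free_add. Proof. free_tac. Qed.
Fact free_addC : commutative free_add. Proof. free_tac. Qed.
Fact free_add0 : left_id free_zero free_add. Proof. free_tac. Qed.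
Fact free_addN : left_inverse free_zero free_opp free_add.
Proof. free_tac. Qed.
HB.instance Definition _ :=
  GRing.isZmodule.Build free_star free_addA free_addC free_add0 free_addN.

Fact free_mulA : associative free_mul. Proof. free_tac. Qed.
Fact free_mul1l : left_id free_one free_mul. Proof. free_tac. Qed.
Fact free_mul1r : right_id free_one free_mul. Proof. free_tac. Qed.
Fact free_mulDl : left_distributive free_mul free_add. Proof. free_tac. Qed.
Fact free_mulDr : right_distributive free_mul free_add. Proof. free_tac. Qed.
Fact free_1neq0 : free_one != free_zero.
Proof.
apply/eqP => /free_eqP /(@term_charP R X (fun=> 0) _ _).
by move/eqP; rewrite /= oner_eq0.
Qed.
HB.instance Definition _ :=
  GRing.Zmodule_isNzRing.Build free_star free_mulA free_mul1l free_mul1r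
    free_mulDl free_mulDr free_1neq0.

Fact free_scaleA k l a : free_scale k (free_scale l a) = free_scale (k * l) a.
Proof. move: a; free_tac. Qed.
Fact free_scale1 : left_id 1 free_scale. Proof. free_tac. Qed.
Fact free_scaleDr : right_distributive free_scale +%R.
Proof. move=> k a b; rewrite /GRing.add /=; move: a b; free_tac. Qed.
Fact free_scaleDl (a : free_star) : {morph free_scale^~ a : k l / k + l}.
Proof.
move=> k l; rewrite /= [RHS]/GRing.add /=; move: a; free_tac.
Qed.
HB.instance Definition _ :=
  GRing.Zmodule_isLmodule.Build R[i] free_star free_scaleA free_scale1
    free_scaleDr free_scaleDl.

Fact free_scaleAl (k : R[i]) (a b : free_star) : k *: (a * b) = (k *: a) * b.
Proof.
rewrite /GRing.scale /GRing.mul /=; move: a b; free_tac.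
Qed.
Fact free_scaleAr (k : R[i]) (a b : free_star) : k *: (a * b) = a * (k *: b).
Proof.
rewrite /GRing.scale /GRing.mul /=; move: a b; free_tac.
Qed.
HB.instance Definition _ :=
  GRing.Lmodule_isLalgebra.Build R[i] free_star free_scaleAl.
HB.instance Definition _ :=
  GRing.Lalgebra_isAlgebra.Build R[i] free_star free_scaleAr.

Fact free_conjD (a b : free_star) :
  free_conj (a + b) = free_conj a + free_conj b.
Proof. rewrite /GRing.add /=; move: a b; free_tac. Qed.
Fact free_conjZ (k : R[i]) (a : free_star) :
  free_conj (k *: a) = Num.conj k *: free_conj a.
Proof. rewrite /GRing.scale /=; move: a; free_tac. Qed.
Fact free_conjM (a b : free_star) :
  free_conj (a * b) = free_conj b * free_conj a.
Proof. rewrite /GRing.mul /=; move: a b; free_tac. Qed.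
Fact free_conjK : involutive free_conj. Proof. free_tac. Qed.
HB.instance Definition _ :=
  isStarAlgebra.Build R free_star free_conjD free_conjZ free_conjM free_conjK.

End FreeStarAlgebra.

(** ** Quotients by *-ideals *)

Definition is_star_ideal (R : realType) (A : starAlgType R) (I : set A) : Prop :=
  [/\ I 0,
      forall a b, I a -> I b -> I (a + b),
      forall a x, I x -> I (a * x),
      forall a x, I x -> I (x * a)
    & forall x, I x -> I (star x)].

Definition star_ideal (R : realType) (A : starAlgType R) (G : set A) : set A :=
  smallest (@is_star_ideal R A) G.

Section StarQuotient.
Context (R : realType) (A : starAlgType R) (G : set A).
Notation J := (star_ideal G).

Lemma star_idealP : is_star_ideal J.
Proof.
split.
- by move=> I [[]].
- move=> a b Ja Jb I IG; have [[_ h _ _ _] _] := IG.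
  by apply: h; [exact: Ja|exact: Jb].
- move=> a x Jx I IG; have [[_ _ h _ _] _] := IG; apply: h; exact: Jx.
- move=> a x Jx I IG; have [[_ _ _ h _] _] := IG; apply: h; exact: Jx.
- move=> x Jx I IG; have [[_ _ _ _ h] _] := IG; apply: h; exact: Jx.
Qed.

Lemma star_ideal0 : J 0. Proof. by case: star_idealP. Qed.
Lemma star_idealD a b : J a -> J b -> J (a + b).
Proof. by have [_ h _ _ _] := star_idealP; exact: h. Qed.
Lemma star_idealMl a x : J x -> J (a * x).
Proof. by have [_ _ h _ _] := star_idealP; exact: h. Qed.
Lemma star_idealMr a x : J x -> J (x * a).
Proof. by have [_ _ _ h _] := star_idealP; exact: h. Qed.
Lemma star_idealS x : J x -> J (star x).
Proof. by have [_ _ _ _ h] := star_idealP; exact: h. Qed.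
Lemma star_idealZ (k : R[i]) x : J x -> J (k *: x).
Proof. by move=> Jx; rewrite -[x]mul1r scalerAl; exact: star_idealMl. Qed.
Lemma star_idealN x : J x -> J (- x).
Proof. by rewrite -scaleN1r; exact: star_idealZ. Qed.

Definition ideal_eqb (a b : A) : bool := `[< J (a - b) >].

Lemma ideal_eqb_refl : reflexive ideal_eqb.
Proof. by move=> a; apply/asboolP; rewrite subrr; exact: star_ideal0. Qed.
Lemma ideal_eqb_sym : symmetric ideal_eqb.
Proof.
by move=> a b; apply/asboolP/asboolP => /star_idealN; rewrite opprB.
Qed.
Lemma ideal_eqb_trans : transitive ideal_eqb.
Proof.
move=> b a c /asboolP ab /asboolP bc; apply/asboolP.
by have := star_idealD ab bc; rewrite addrA subrK.
Qed.

Canonical ideal_equiv :=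
  EquivRel ideal_eqb ideal_eqb_refl ideal_eqb_sym ideal_eqb_trans.

(* The ideal is required to be proper because algType excludes the zero
   algebra. *)
Definition star_quot (_ : ~ J 1) := {eq_quot ideal_equiv}.

Context (proper : ~ J 1).
Notation Q := (star_quot proper).
HB.instance Definition _ := Choice.on Q.

Definition quot_pi (a : A) : Q := \pi_{eq_quot ideal_equiv} a.
Definition quot_repr (a : Q) : A := repr (a : {eq_quot ideal_equiv}).

Lemma quot_eqP (a b : A) : J (a - b) <-> quot_pi a = quot_pi b.
Proof.
by split=> [ab|/eqmodP /asboolP //]; apply/eqmodP/asboolP.
Qed.

Lemma quot_reprK (a : Q) : quot_pi (quot_repr a) = a.
Proof. exact: reprK. Qed.

Lemma repr_quot (a : A) : J (quot_repr (quot_pi a) - a).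
Proof. by apply/quot_eqP; rewrite quot_reprK. Qed.

Definition quot_add (a b : Q) : Q := quot_pi (quot_repr a + quot_repr b).
Definition quot_opp (a : Q) : Q := quot_pi (- quot_repr a).
Definition quot_mul (a b : Q) : Q := quot_pi (quot_repr a * quot_repr b).
Definition quot_scale (k : R[i]) (a : Q) : Q := quot_pi (k *: quot_repr a).
Definition quot_star (a : Q) : Q := quot_pi (star (quot_repr a)).

Lemma quot_addE a b : quot_add (quot_pi a) (quot_pi b) = quot_pi (a + b).
Proof.
apply/quot_eqP; rewrite opprD addrACA.
by apply: star_idealD; exact: repr_quot.
Qed.
Lemma quot_oppE a : quot_opp (quot_pi a) = quot_pi (- a).
Proof. by apply/quot_eqP; rewrite -opprD; apply: star_idealN; exact: repr_quot. Qed.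
Lemma quot_mulE a b : quot_mul (quot_pi a) (quot_pi b) = quot_pi (a * b).
Proof.
apply/quot_eqP; set a' := quot_repr _; set b' := quot_repr _.
have -> : a' * b' - a * b = (a' - a) * b' + a * (b' - b).
  by rewrite mulrBl mulrBr addrA subrK.
by apply: star_idealD; [apply: star_idealMr|apply: star_idealMl];
  exact: repr_quot.
Qed.
Lemma quot_scaleE k a : quot_scale k (quot_pi a) = quot_pi (k *: a).
Proof. by apply/quot_eqP; rewrite -scalerBr; apply: star_idealZ; exact: repr_quot. Qed.
Lemma quot_starE a : quot_star (quot_pi a) = quot_pi (star a).
Proof.
apply/quot_eqP.
have -> : star (quot_repr (quot_pi a)) - star a = star (quot_repr (quot_pi a) - a).
  by rewrite starD -[in RHS]scaleN1r starZ rmorphN rmorph1 scaleN1r.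
by apply: star_idealS; exact: repr_quot.
Qed.

Let quotE := (quot_addE, quot_oppE, quot_mulE, quot_scaleE, quot_starE).

Lemma quot_ind (P : Q -> Prop) : (forall t, P (quot_pi t)) -> forall a, P a.
Proof. by move=> h a; rewrite -[a]quot_reprK. Qed.

Fact quot_addA : associative quot_add.
Proof. by do 3 elim/quot_ind=> ?; rewrite !quotE addrA. Qed.
Fact quot_addC : commutative quot_add.
Proof. by do 2 elim/quot_ind=> ?; rewrite !quotE addrC. Qed.
Fact quot_add0 : left_id (quot_pi 0) quot_add.
Proof. by elim/quot_ind=> ?; rewrite !quotE add0r. Qed.
Fact quot_addN : left_inverse (quot_pi 0) quot_opp quot_add.
Proof. by elim/quot_ind=> ?; rewrite !quotE addNr. Qed.
HB.instance Definition _ :=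
  GRing.isZmodule.Build Q quot_addA quot_addC quot_add0 quot_addN.

Fact quot_mulA : associative quot_mul.
Proof. by do 3 elim/quot_ind=> ?; rewrite !quotE mulrA. Qed.
Fact quot_mul1l : left_id (quot_pi 1) quot_mul.
Proof. by elim/quot_ind=> ?; rewrite !quotE mul1r. Qed.
Fact quot_mul1r : right_id (quot_pi 1) quot_mul.
Proof. by elim/quot_ind=> ?; rewrite !quotE mulr1. Qed.
Fact quot_mulDl : left_distributive quot_mul quot_add.
Proof. by do 3 elim/quot_ind=> ?; rewrite !quotE mulrDl. Qed.
Fact quot_mulDr : right_distributive quot_mul quot_add.
Proof. by do 3 elim/quot_ind=> ?; rewrite !quotE mulrDr. Qed.
Fact quot_1neq0 : quot_pi 1 != quot_pi 0.
Proof. by apply/eqP => /quot_eqP; rewrite subr0. Qed.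
HB.instance Definition _ :=
  GRing.Zmodule_isNzRing.Build Q quot_mulA quot_mul1l quot_mul1r
    quot_mulDl quot_mulDr quot_1neq0.

Fact quot_scaleA k l a : quot_scale k (quot_scale l a) = quot_scale (k * l) a.
Proof. by elim/quot_ind: a => ?; rewrite !quotE scalerA. Qed.
Fact quot_scale1 : left_id 1 quot_scale.
Proof. by elim/quot_ind=> ?; rewrite !quotE scale1r. Qed.
Fact quot_scaleDr : right_distributive quot_scale +%R.
Proof.
move=> k; rewrite /GRing.add /=.
by do 2 elim/quot_ind=> ?; rewrite !quotE scalerDr.
Qed.
Fact quot_scaleDl (a : Q) : {morph quot_scale^~ a : k l / k + l}.
Proof.
move=> k l; rewrite /= [RHS]/GRing.add /=.
by elim/quot_ind: a => ?; rewrite !quotE scalerDl.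
Qed.
HB.instance Definition _ :=
  GRing.Zmodule_isLmodule.Build R[i] Q quot_scaleA quot_scale1
    quot_scaleDr quot_scaleDl.

Fact quot_scaleAl (k : R[i]) (a b : Q) : k *: (a * b) = (k *: a) * b.
Proof.
rewrite /GRing.scale /GRing.mul /=.
by elim/quot_ind: a => ?; elim/quot_ind: b => ?; rewrite !quotE scalerAl.
Qed.
Fact quot_scaleAr (k : R[i]) (a b : Q) : k *: (a * b) = a * (k *: b).
Proof.
rewrite /GRing.scale /GRing.mul /=.
by elim/quot_ind: a => ?; elim/quot_ind: b => ?; rewrite !quotE scalerAr.
Qed.
HB.instance Definition _ := GRing.Lmodule_isLalgebra.Build R[i] Q quot_scaleAl.
HB.instance Definition _ := GRing.Lalgebra_isAlgebra.Build R[i] Q quot_scaleAr.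

Fact quot_starD (a b : Q) : quot_star (a + b) = quot_star a + quot_star b.
Proof.
rewrite /GRing.add /=.
by elim/quot_ind: a => ?; elim/quot_ind: b => ?; rewrite !quotE starD.
Qed.
Fact quot_starZ (k : R[i]) (a : Q) :
  quot_star (k *: a) = Num.conj k *: quot_star a.
Proof.
by rewrite /GRing.scale /=; elim/quot_ind: a => ?; rewrite !quotE starZ.
Qed.
Fact quot_starM (a b : Q) : quot_star (a * b) = quot_star b * quot_star a.
Proof.
rewrite /GRing.mul /=.
by elim/quot_ind: a => ?; elim/quot_ind: b => ?; rewrite !quotE starM.
Qed.
Fact quot_starK : involutive quot_star.
Proof. by elim/quot_ind=> ?; rewrite !quotE starK. Qed.
HB.instance Definition _ :=
  isStarAlgebra.Build R Q quot_starD quot_starZ quot_starM quot_starK.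

End StarQuotient.

(** ** Podles spheres *)

Inductive podles_gen := GenA | GenB.

(* The parameter c ranges over ]0, +oo]; a value r%:E is a finite c, anything
   else is read as c = +oo. *)
Definition podles_relators (R : realType) (q : R) (c : \bar R) :
    set (free_star R podles_gen) :=
  let A := free_gen R GenA in
  let B := free_gen R GenB in
  let Q := (q%:C)%C in
  match c with
  | r%:E =>
    [set star A - A;
         B * A - Q ^+ 2 *: (A * B);
         star B * B - (A - A ^+ 2 + (r%:C)%C *: 1);
         B * star B - (Q ^+ 2 *: A - Q ^+ 4 *: A ^+ 2 + (r%:C)%C *: 1)]
  | _ =>
    [set star A - A;
         B * A - Q ^+ 2 *: (A * B);
         star B * B - (- A ^+ 2 + 1);
         B * star B - (- (Q ^+ 4 *: A ^+ 2) + 1)]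
  end.

(* The *-character A |-> 0, B |-> z shows that the ideal is proper. *)
Lemma podles_character (R : realType) (q z : R) (c : \bar R) :
  (if c is r%:E then r else 1) = z ^+ 2 -> ~ star_ideal (podles_relators q c) 1.
Proof.
move=> cz.
pose f x : R[i] := if x is GenA then 0 else (z%:C)%C.
pose h (a : free_star R podles_gen) := term_char f (repr a).
have hE t : h (\pi_(free_star R podles_gen) t) = term_char f t.
  by apply: term_charP; exact: repr_free.
have termE (a : free_star R podles_gen) : term_char f (repr a) = h a by [].
have hD a b : h (a + b) = h a + h b by rewrite [LHS]hE.
have hM a b : h (a * b) = h a * h b by rewrite [LHS]hE.
have hZ k a : h (k *: a) = k * h a by rewrite [LHS]hE.
have hS a : h (star a) = Num.conj (h a) by rewrite [LHS]hE.
have h1 : h 1 = 1 by rewrite [LHS]hE.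
have h0 : h 0 = 0 by rewrite [LHS]hE.
have hN a : h (- a) = - h a by rewrite -scaleN1r hZ mulN1r.
have hA : h (free_gen R GenA) = 0 by rewrite [LHS]hE.
have hB : h (free_gen R GenB) = (z%:C)%C by rewrite [LHS]hE.
have hI : is_star_ideal [set a | h a = 0].
  split=> [|a b /= ha hb|a b /= hb|a b /= hb|a /= ha] /=.
  - exact: h0.
  - by rewrite hD ha hb addr0.
  - by rewrite hM hb mulr0.
  - by rewrite hM hb mul0r.
  - by rewrite hS ha rmorph0.
have zc : Num.conj (z%:C)%C = (z%:C)%C :> R[i].
  by apply/CrealP; rewrite complex_real.
move=> J1; suff : h 1 = 0 by rewrite h1 => /eqP; rewrite oner_eq0.
apply: (J1 [set a | h a = 0]); split; first exact: hI.
have zr : (z%:C)%C * (z%:C)%C = ((if c is r%:E then r else 1)%:C)%C :> R[i].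
  by rewrite cz expr2 -rmorphM.
case: c cz zr {J1} => [r||] _ zr a /= [[[|]|]|] -> /=;
  rewrite ?expr2 !(hD, hN, hM, hZ, hS, hA, hB, h1) ?zc ?zr;
  rewrite ?rmorph0 ?rmorph1 !(mulr0, mul0r, mulr1, oppr0, addr0, add0r, subrr) //.
Qed.

Lemma podles_proper (R : realType) (q : R) (c : \bar R) : (0 < c)%E ->
  ~ star_ideal (podles_relators q c) 1.
Proof.
case: c => [r r0|_|//]; last by apply: (@podles_character _ _ 1); rewrite expr1n.
by apply: (@podles_character _ _ (Num.sqrt r)); rewrite sqr_sqrtr // ltW.
Qed.

Arguments podles_proper {R} q {c} c0.

(* P(S^2_{qc}) *)
Definition podles (R : realType) (q : R) (c : \bar R) (c0 : (0 < c)%E) :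
    starAlgType R :=
  star_quot (podles_proper q c0).

Definition podlesA (R : realType) (q : R) (c : \bar R) (c0 : (0 < c)%E) :
    podles q c0 :=
  quot_pi (podles_proper q c0) (free_gen R GenA).
Definition podlesB (R : realType) (q : R) (c : \bar R) (c0 : (0 < c)%E) :
    podles q c0 :=
  quot_pi (podles_proper q c0) (free_gen R GenB).

(* lambda_+ for s = true, lambda_- for s = false; at c = +oo these are the
   signs in pi_+ and pi_-. *)
Definition podles_lambda (R : realType) (c : \bar R) (s : bool) : R :=
  match c with
  | r%:E => 2^-1 + (if s then 1 else -1) * Num.sqrt (r + 4^-1)
  | _ => if s then 1 else -1
  end.

Definition podles_weight (R : realType) (q : R) (c : \bar R) (s : bool)
    (k : nat) : R :=
  let l := podles_lambda c s in
  match c with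
  | r%:E => l * q ^+ (2 * k) - (l * q ^+ (2 * k)) ^+ 2 + r
  | _ => 1 - q ^+ (4 * k)
  end.

Section PodlesRepresentations.
Context (R : realType) (q : R) (c : \bar R) (c0 : (0 < c)%E).
Context (X : cstar_closure (podles q c0)).

Definition podles_representation (H : hilbertType R) (e : nat -> H) (s : bool)
    (p : X -> H -> H) : Prop :=
  [/\ cstar_representation p,
      forall k, p (closure_in X (podlesA q c0)) (e k) =
        ((podles_lambda c s * q ^+ (2 * k))%:C)%C *: e k,
      p (closure_in X (podlesB q c0)) (e 0%N) = 0
    & forall k, p (closure_in X (podlesB q c0)) (e k.+1) =
        ((Num.sqrt (podles_weight q c s k.+1))%:C)%C *: e k].

Definition podles_delta (g : R[i]) (d : {lrmorphism X -> X}) : Prop :=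
  [/\ cstar_automorphism d,
      d (closure_in X (podlesA q c0)) = closure_in X (podlesA q c0)
    & d (closure_in X (podlesB q c0)) =
        g ^+ 2 *: closure_in X (podlesB q c0)].

End PodlesRepresentations.

(* (p1 (+) p2)^-1 o (p1c (+) p2c); meaningful when p1 (+) p2 is injective with
   range containing that of p1c (+) p2c. *)
Definition podles_chi (R : realType) (H : hilbertType R)
    (X Y : cstarAlgType R) (p1c p2c : X -> H -> H) (p1 p2 : Y -> H -> H) :
    X -> Y :=
  'pinv_(fun=> 0) [set: Y] (rep_sum p1 p2) \o rep_sum p1c p2c.

(* Main.v *)
Require Import Defs.
From HB Require Import structures.
From mathcomp Require Import all_boot all_order all_algebra ring.
From mathcomp Require Import generic_quotient complex.
From mathcomp Require Import all_classical all_reals all_analysis.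

Set Implicit Arguments.
Unset Strict Implicit.
Unset Printing Implicit Defensive.

Import Order.TTheory GRing.Theory Num.Theory numFieldNormedType.Exports.

Local Open Scope classical_set_scope.
Local Open Scope quotient_scope.
Local Open Scope ring_scope.

(** Each of the representations in play is a weighted shift: A is diagonal and B
    lowers the basis by one step. Hence the unitary U with U e_k = g^(-2k) e_k
    implements the rotation d by g, as p (d a) = U (p a) U^*. The same U serves
    for X and for Y, since it depends on neither the weights nor the sign, so
    that if y and x have the same image under the representations then so do
    dY y and dX x. This says that dY y is the value of chi at dX x whenever y is
    the value of chi at x, because the sum of the two representations of Y is
    injective.

    The covariance is written in matrix coefficients, which saves constructing
    U (podles_delta_coef):
      <p (d a) e_j, e_k> g^(2k) = g^(2j) <p a e_j, e_k>.
    For fixed k, the a satisfying this for every j form a closed linear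
    subspace; it contains 1 and is stable under right multiplication by A, B
    and B^*, because these send e_j to a multiple of a basis vector. Such a
    subspace is everything (podles_ind). Matrix coefficients determine an
    operator that has an adjoint (operator_ext), which gives the conclusion. *)

(** * Matrix coefficients in an orthonormal basis *)

Section HilbertSpace.
Context (R : realType) (H : hilbertType R).
Implicit Types u v w : H.

Lemma innerDl u v w : inner (u + v) w = inner u w + inner v w.
Proof. by rewrite -{1}[u]scale1r inner_linear mul1r. Qed.

Lemma inner0l w : inner (0 : H) w = 0.
Proof. by apply: (addrI (inner (0 : H) w)); rewrite -innerDl !addr0. Qed.

Lemma innerZl (k : R[i]) u w : inner (k *: u) w = k * inner u w.
Proof. by rewrite -[k *: u]addr0 inner_linear inner0l addr0. Qed.

Lemma innerZr (k : R[i]) u w : inner u (k *: w) = Num.conj k * inner u w.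
Proof. by rewrite inner_conj innerZl rmorphM /= -inner_conj. Qed.

Lemma innerDr u v w : inner u (v + w) = inner u v + inner u w.
Proof. by rewrite inner_conj innerDl rmorphD /= -!inner_conj. Qed.

(** Cauchy-Schwarz for a unit vector w: the component of u orthogonal to w has
    nonnegative squared norm. *)
Lemma inner_unit_le u w : `|w| = 1 -> `|inner u w| <= `|u|.
Proof.
move=> w1; have := exprn_ge0 2 (normr_ge0 (u - inner u w *: w)).
rewrite -inner_norm innerDl -scaleNr !innerDr !innerZl !innerZr !inner_norm.
rewrite w1 expr1n rmorphN /= (inner_conj u w) => h.
have {h} : 0 <= `|u| ^+ 2 - `|inner u w| ^+ 2.
  by rewrite normCK; apply: le_trans h _; rewrite le_eqVlt; apply/orP; left;
    apply/eqP; ring.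
by rewrite subr_ge0 ler_pXn2r // nnegrE.
Qed.

End HilbertSpace.

Section OrthonormalBasis.
Context (R : realType) (H : hilbertType R) (e : nat -> H).
Hypothesis he : orthonormal_basis e.

Lemma basis_norm k : `|e k| = 1.
Proof.
apply/eqP; rewrite -(@pexpr_eq1 _ _ 2) // -inner_norm.
by rewrite (proj1 he) eqxx.
Qed.

Lemma basis_ext u v : (forall k, inner u (e k) = inner v (e k)) -> u = v.
Proof.
move=> uv; have [_ h] := he; have := h v.
have -> : (fun k => inner v (e k) *: e k) = (fun k => inner u (e k) *: e k).
  by apply/funext => k; rewrite uv.
by move=> hv; exact: (cvg_unique _ (h u) hv).
Qed.

(** Passing to adjoints replaces boundedness: the coefficients of the T_i
    determine the vectors T_i' e_k, hence every <T_i v, e_k>. *)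
Lemma operator_ext (T1 T1' T2 T2' : H -> H) :
  adjoint_operators T1 T1' -> adjoint_operators T2 T2' ->
  (forall j k, inner (T1 (e j)) (e k) = inner (T2 (e j)) (e k)) -> T1 = T2.
Proof.
move=> a1 a2 h; apply/funext => v; apply: basis_ext => k.
rewrite a1 a2; congr inner; apply: basis_ext => j.
by rewrite inner_conj -a1 h a2 -inner_conj.
Qed.

Lemma adjoint_lowering (T T' : H -> H) (w : nat -> R[i]) :
  adjoint_operators T T' -> T (e 0%N) = 0 ->
  (forall k, T (e k.+1) = w k *: e k) ->
  forall k, T' (e k) = Num.conj (w k) *: e k.+1.
Proof.
move=> aT T0 TS k; apply: basis_ext => l.
rewrite inner_conj -aT innerZl (proj1 he).
case: l => [|l]; first by rewrite T0 inner0l rmorph0 mulr0.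
rewrite TS innerZl (proj1 he) rmorphM /= rmorph_nat eqSS eq_sym.
by case: eqVneq => [->|]; rewrite ?mulr0.
Qed.

End OrthonormalBasis.

(** * The algebra generated by A and B *)

Lemma podlesA_star (R : realType) (q : R) (c : \bar R) (c0 : (0 < c)%E) :
  star (podlesA q c0) = podlesA q c0.
Proof.
have -> : star (podlesA q c0) =
    quot_pi (podles_proper q c0) (star (free_gen R GenA)).
  exact: quot_starE.
apply/quot_eqP => I [_]; apply; rewrite /podles_relators.
by case: (c) => [r||]; do 3 left.
Qed.

(** The products of generators and their adjoints span a dense subspace. Only
    right multiplication by a generator is asked of P, and not stability under
    products: this is what matrix coefficients can check without summing over
    intermediate basis vectors. *)
Lemma podles_ind (R : realType) (q : R) (c : \bar R) (c0 : (0 < c)%E)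
    (X : cstar_closure (podles q c0)) (P : set X) :
  let A := closure_in X (podlesA q c0) in
  let B := closure_in X (podlesB q c0) in
  P 1 -> (forall a b, P a -> P b -> P (a + b)) ->
  (forall k a, P a -> P (k *: a)) ->
  (forall a, P a -> P (a * A)) -> (forall a, P a -> P (a * B)) ->
  (forall a, P a -> P (a * star B)) ->
  (forall a, (forall eps : R, 0 < eps -> exists2 b, P b & cnorm (a - b) < eps)
     -> P a) ->
  forall a, P a.
Proof.
move=> A B P1 PD PZ PA PB PBs Pcl a; apply: Pcl => eps eps0.
have [p ap] := closure_in_dense a eps0; exists (closure_in X p) => //.
elim/quot_ind: p {ap} => p; elim/free_ind: p => t0.
pose f t : X :=
  closure_in X (quot_pi (podles_proper q c0) (\pi_(free_star R podles_gen) t)).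
have P0 : P 0 by rewrite -(scale0r (1 : X)); exact: PZ.
have fD s t : f (TAdd s t) = f s + f t.
  by rewrite -rmorphD; congr (closure_in X _);
    rewrite [RHS]quot_addE [in RHS]/GRing.add /= free_addE.
have fM s t : f (TMul s t) = f s * f t.
  by rewrite -rmorphM; congr (closure_in X _);
    rewrite [RHS]quot_mulE [in RHS]/GRing.mul /= free_mulE.
have fZ k t : f (TScale k t) = k *: f t.
  by rewrite -linearZ; congr (closure_in X _);
    rewrite [RHS]quot_scaleE [in RHS]/GRing.scale /= free_scaleE.
have fS t : f (TStar t) = star (f t).
  rewrite -closure_in_star; congr (closure_in X _).
  by rewrite [RHS]quot_starE [in RHS]/star /= free_conjE.
have f0 : f TZero = 0 by rewrite -(rmorph0 (closure_in X)).
have f1 : f TOne = 1 by rewrite -(rmorph1 (closure_in X)).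
(* Quantifying over a makes products of terms and adjoints go through. *)
suff step s : forall a, P a -> P (a * f s) /\ P (a * star (f s)).
  by have [] := step t0 1 P1; rewrite mul1r.
have fA : f (TGen GenA) = A by [].
have fB : f (TGen GenB) = B by [].
have sA : star A = A by rewrite /A -closure_in_star podlesA_star.
have s0 : star (0 : X) = 0.
  by rewrite -{1}(scale0r (0 : X)) starZ rmorph0 scale0r.
have s1 : star (1 : X) = 1.
  by rewrite -[LHS]mulr1 -{2}[1]starK -starM mulr1 starK.
elim: s => [[]|||s IHs t' IHt|k s IHs|s IHs t' IHt|s IHs] b Pb.
- by rewrite fA sA; split; exact: PA.
- by rewrite fB; split; [exact: PB|exact: PBs].
- by rewrite f0 s0 mulr0.
- by rewrite f1 s1 mulr1.
- rewrite fD starD !mulrDr.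
  by have [? ?] := IHs _ Pb; have [? ?] := IHt _ Pb; split; exact: PD.
- by rewrite fZ starZ -!scalerAr; have [? ?] := IHs _ Pb; split; exact: PZ.
- rewrite fM starM !mulrA.
  have [/IHt [? _] _] := IHs _ Pb; have [_ /IHs [_ ?]] := IHt _ Pb.
  by split.
- by rewrite fS starK; have [? ?] := IHs _ Pb.
Qed.

(** * Covariance of the representations *)

Lemma representation_coef_le (R : realType) (A : cstarAlgType R)
    (H : hilbertType R) (p : A -> H -> H) (u w : H) : cstar_representation p ->
  `|u| = 1 -> `|w| = 1 ->
  forall a, `|inner (p a u) w| <= ((cnorm a)%:C)%C.
Proof.
move=> [_ pn] u1 w1 a; apply: le_trans (inner_unit_le _ w1) _.
have -> : `|p a u| = ((complex.Re `|p a u|)%:C)%C.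
  by rewrite RRe_real// normr_real.
rewrite lecR -lee_fin; apply: le_trans (pn a).
by apply: ereal_sup_ubound; exists u; rewrite //= u1.
Qed.

(** The relation p (d a) = U (p a) U^* for U e_k = g^(-2k) e_k, cleared of
    inverse powers of g. On the generators it holds because d multiplies B,
    which lowers the index by one, by g^2, and fixes A, which preserves it. *)
Lemma podles_delta_coef (R : realType) (q : R) (c : \bar R) (c0 : (0 < c)%E)
    (X : cstar_closure (podles q c0)) (H : hilbertType R) (e : nat -> H)
    (he : orthonormal_basis e) (s : bool) (p : X -> H -> H)
    (hp : podles_representation e s p) (g : R[i]) (hg : unit_circle g)
    (d : {lrmorphism X -> X}) (hd : podles_delta g d) a j k :
  inner (p (d a) (e j)) (e k) * g ^+ (2 * k) =
  g ^+ (2 * j) * inner (p a (e j)) (e k).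
Proof.
have [hpc pA pB0 pBS] := hp; have [[pb [p1 pD pZ pM pS]] _] := hpc.
have [[dS _ dn] dA dB] := hd.
have g1 : g * Num.conj g = 1 by rewrite -normCK hg expr1n.
have pBs i : p (star (closure_in X (podlesB q c0))) (e i) =
    ((Num.sqrt (podles_weight q c s i.+1))%:C)%C *: e i.+1.
  rewrite (adjoint_lowering he (pS _) pB0 pBS); congr (_ *: _).
  by apply/CrealP; rewrite complex_real.
have pl b (r : R[i]) v : p b (r *: v) = r *: p b v.
  by have [l _] := pb b; exact: (GRing.scalable_linear l).
have p0 b : p b 0 = 0 by rewrite -(scale0r (0 : H)) pl !scale0r.
have coef_le := representation_coef_le hpc (basis_norm he _) (basis_norm he _).
pose P : set X := fun b => forall j,
  inner (p (d b) (e j)) (e k) * g ^+ (2 * k) =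
  g ^+ (2 * j) * inner (p b (e j)) (e k).
move: j; suff : P a by [].
apply: podles_ind a => [|a b IHa IHb|r a IHa|a IHa|a IHa|a IHa|a cl_a] j.
- rewrite rmorph1 p1 (proj1 he).
  by case: eqVneq => [->|]; rewrite ?mulr0 ?mul0r // mul1r mulr1.
- by rewrite rmorphD !pD /= !innerDl mulrDl mulrDr IHa IHb.
- by rewrite linearZ !pZ /= !innerZl -mulrA IHa mulrCA.
- by rewrite rmorphM /= dA !pM /= pA !pl !innerZl -mulrA IHa mulrCA.
- rewrite rmorphM /= dB /= !pM pZ /=.
  case: j => [|j]; first by rewrite pB0 scaler0 !p0 inner0l mul0r mulr0.
  by rewrite pBS !pl !innerZl mulnS exprD -!mulrA IHa; ring.
- rewrite rmorphM /= dS dB starZ /= !pM pZ /=.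
  rewrite pBs !pl !innerZl -!mulrA IHa mulnS exprD rmorphXn /=.
  (* B^* raises the index, and d B^* = conj(g)^2 B^* with g conj(g) = 1. *)
  by rewrite -[RHS]mul1r -(expr1n _ 2%N) -g1; ring.
(* The defect F of the relation is linear in a and at most 2 |a|, so that it
   vanishes on limits of elements on which it vanishes. *)
pose F b := inner (p (d b) (e j)) (e k) * g ^+ (2 * k) -
  g ^+ (2 * j) * inner (p b (e j)) (e k).
have gn n : `|g ^+ n| = 1 by rewrite normrX hg expr1n.
have F_le b : `|F b| <= ((2 * cnorm b)%:C)%C.
  apply: le_trans (ler_normB _ _) _; rewrite !normrM !gn mulr1 mul1r.
  rewrite mulrDl mul1r rmorphD /=; apply: lerD; last exact: coef_le.
  by apply: le_trans (coef_le _ _ _) _; rewrite lecR.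
apply/eqP; rewrite -subr_eq0 -normr_le0 -/(F a).
have -> : `|F a| = ((complex.Re `|F a|)%:C)%C by rewrite RRe_real// normr_real.
rewrite lecR; apply/ler_addgt0Pr => eps eps0; rewrite add0r.
have [b Fb ab] := cl_a (eps / 2) (divr_gt0 eps0 (ltr0n _ 2)).
have -> : F a = F (a - b).
  have dN : d (-1 *: b) = -1 *: d b by rewrite linearZ.
  rewrite -(scaleN1r b) /F rmorphD /= dN !pD !pZ /= !innerDl !innerZl.
  by rewrite mulrDl mulrDr -[_ * inner _ _ * _]mulrA Fb; ring.
have := F_le (a - b); rewrite lecE => /andP[_ /= /le_trans]; apply.
by rewrite ltW // mulrC -ltr_pdivlMr.
Qed.

Theorem proposition2p4 (R : realType) (q : R) (hq : 0 < `|q| < 1)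
  (c : \bar R) (c0 : (0 < c)%E)
  (* C(S^2_{qc}) and C(S^2_{q oo}) *)
  (X : cstar_closure (podles q c0))
  (Y : cstar_closure (podles q (ltry (0 : R))))
  (H : hilbertType R) (e : nat -> H) (he : orthonormal_basis e)
  (S : H -> H) (hS : is_shift e S)
  (sigma : (H -> H) -> R[i]^o -> R[i]^o) (hsigma : symbol_map S sigma)
  (piXp piXm : X -> H -> H)
  (hpiXp : podles_representation e true piXp)
  (hpiXm : podles_representation e false piXm)
  (piYp piYm : Y -> H -> H)
  (hpiYp : podles_representation e true piYp)
  (hpiYm : podles_representation e false piYm)
  (* the known isomorphisms onto the fibre product, on which chi_c rests *)
  (isoX : set_bij [set: X] (fibre_product S sigma) (rep_sum piXp piXm))
  (isoY : set_bij [set: Y] (fibre_product S sigma) (rep_sum piYp piYm))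
  (g : R[i]) (hg : unit_circle g)
  (dX : {lrmorphism X -> X}) (hdX : podles_delta g dX)
  (dY : {lrmorphism Y -> Y}) (hdY : podles_delta g dY) :
  dY \o podles_chi piXp piXm piYp piYm = podles_chi piXp piXm piYp piYm \o dX.
Proof.
have [Xfun _ _] := isoX; have [_ Yinj Ysurj] := isoY.
have chiE x : rep_sum piYp piYm (podles_chi piXp piXm piYp piYm x) =
    rep_sum piXp piXm x.
  by rewrite /podles_chi /=; apply: surjpK Ysurj _ _; apply/mem_set/Xfun.
have gn0 n : g ^+ n != 0.
  by rewrite expf_neq0 // -normr_gt0 hg ltr01.
(* One sign at a time, dX and dY act by the same unitary conjugation. *)
have dchi s (pX : X -> H -> H) (pY : Y -> H -> H) x y :
    podles_representation e s pX -> podles_representation e s pY ->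
    pY y = pX x -> pY (dY y) = pX (dX x).
  move=> hX hY yx.
  have [[[_ [_ _ _ _ aX]] _] _ _ _] := hX.
  have [[[_ [_ _ _ _ aY]] _] _ _ _] := hY.
  apply: (operator_ext he (aY _) (aX _)) => j k.
  apply: (mulIf (gn0 (2 * k)%N)).
  rewrite (podles_delta_coef he hX hg hdX) (podles_delta_coef he hY hg hdY).
  by rewrite yx.
apply/funext => x /=; apply: Yinj; rewrite ?in_setT // chiE.
have [yp ym] := chiE x.
by congr pair; [exact: dchi hpiXp hpiYp yp|exact: dchi hpiXm hpiYm ym].
Qed.
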